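(* Let $q$ be a prime and let $f(x), g(x) \in \mathbb{Z}[x]$ be polynomials that are not identically zero in $\mathbb{Z}_q$ (i.e., each has at least one coefficient not divisible by $q$). If the system of congruences $f(x) \equiv 0 \pmod{q}$, $g(x) \equiv 0 \pmod{q}$ has $\ell$ solutions (residues $x \in \mathbb{Z}_q$), then $R(f(x), g(x)) \equiv 0 \pmod{q^\ell}$.
   Context: For $f(x)=\sum_{i=0}^n a_i x^i$ and $g(x)=\sum_{j=0}^m b_j x^j$ with $a_n\neq 0$, $b_m\neq 0$ (degrees $n$ and $m$ over $\mathbb{Z}$), the resultant $R(f,g)$ is the determinant of the Sylvester matrix of $f$ and $g$; equivalently $R(f,g)=a_n^m b_m^n\prod_{i=1}^n\prod_{j=1}^m(\alpha_i-\beta_j)=a_n^m\prod_{i=1}^n g(\alpha_i)$, where $\alpha_i$ and $\beta_j$ are the complex roots of $f$ and $g$, repeated according to multiplicity. $\mathbb{Z}_q$ denotes the integers modulo $q$. *)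

(* Defs.v *)
From HB Require Import structures.
From mathcomp Require Import all_boot all_order all_algebra.

Set Implicit Arguments.
Unset Strict Implicit.
Unset Printing Implicit Defensive.

Import Order.TTheory GRing.Theory Num.Theory.
Local Open Scope ring_scope.

(* [resultant f g] of mxpoly is the determinant of the Sylvester matrix of f
   and g with coefficients listed from low to high degree, so it equals the
   value a_n^m \prod_i g(alpha_i) up to the sign (-1)^(n m).  The sign is
   irrelevant for divisibility by a power of q. *)

(* Residues modulo q are represented by their representatives 0, ..., q - 1. *)
Definition common_roots_mod (q : nat) (f g : {poly int}) : {set 'I_q} :=
  [set x : 'I_q | (f.[x%:Z] == 0 %[mod q])%Z && (g.[x%:Z] == 0 %[mod q])%Z].

(* Main.v *)
(** Let [x_1, ..., x_l] be the common roots modulo [q].  Multiplying the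
    Sylvester matrix by the Vandermonde columns [(x_k ^ j)_j] evaluates
    ['X^i * f] and ['X^i * g] at the [x_k], so these [l] columns of the product
    are divisible by [q].  Completing the Vandermonde columns with unit vectors
    yields a square matrix whose determinant [\prod_(i < j) (x_j - x_i)] is prime
    to [q]; hence [q ^ l] divides the determinant of the Sylvester matrix. *)
Require Import Defs.
From HB Require Import structures.
From mathcomp Require Import all_boot all_order all_algebra.
Import Order.TTheory GRing.Theory Num.Theory.
Local Open Scope ring_scope.

(** Dividing the [l] columns of [A] by [a] splits off a diagonal factor of determinant [a ^+ l]. *)
Lemma dvdz_det_row_mx (a : int) (l e : nat)
    (A : 'M[int]_(l + e, l)) (B : 'M[int]_(l + e, e)) :
  (forall i j, (a %| A i j)%Z) -> (a ^+ l %| \det (row_mx A B))%Z.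
Proof.
move=> dvA; pose A' := map_mx (divz^~ a) A.
have -> : row_mx A B = row_mx A' B *m block_mx a%:M 0 0 1%:M.
  rewrite mul_row_block !mulmx0 mulmx1 addr0 add0r; congr row_mx.
  by apply/matrixP=> i j; rewrite mul_mx_scalar !mxE mulrC divzK.
by rewrite det_mulmx det_lblock det_scalar det1 mulr1 dvdz_mull.
Qed.

Lemma dvdz_det_Vandermonde (a : int) (l d : nat) (S : 'M[int]_d)
    (x : 'rV[int]_l) :
    (l <= d)%N ->
    (forall i j : 'I_l, (i < j)%N -> coprimez a (x 0 j - x 0 i)) ->
    (forall i k, (a %| (S *m Vandermonde d x) i k)%Z) ->
  (a ^+ l %| \det S)%Z.
Proof.
move=> /subnKC; move: (d - l)%N => e De; case: d / De S => S cop_x dvS.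
(* The unit columns occupy the last [e] rows, so [U] is block lower triangular with the square
   Vandermonde matrix of [x] as its upper left block. *)
pose U := row_mx (Vandermonde (l + e) x) (col_mx 0 1%:M).
have dvSU : (a ^+ l %| \det S * \det U)%Z.
  by rewrite -det_mulmx mul_mx_row; apply: dvdz_det_row_mx.
have detU : \det U = \prod_(i < l) \prod_(j < l | (i < j)%N) (x 0 j - x 0 i).
  rewrite -det_Vandermonde.
  rewrite /U -[Vandermonde (l + e) x]vsubmxK -block_mxEh det_lblock det1 mulr1.
  by congr (\det _); apply/matrixP=> i j; rewrite !mxE.
rewrite Gauss_dvdzl // in dvSU; apply: coprimezXl; rewrite detU.
elim/big_ind: _ => [|u v cu cv|i _]; first by rewrite coprimezE coprimen1.
  by rewrite coprimezMr cu.
elim/big_ind: _ => [|u v cu cv|j lt_ij]; first by rewrite coprimezE coprimen1.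
  by rewrite coprimezMr cu.
exact: cop_x.
Qed.

(** Row [i] holds the coefficients of ['X^j * f] or ['X^j * g], and column [k] the powers of
    [x 0 k]. *)
Lemma Sylvester_mx_Vandermonde (R : comNzRingType) (f g : {poly R}) (l : nat)
    (x : 'rV[R]_l) (i : 'I_((size g).-1 + (size f).-1)) (k : 'I_l) :
  (Sylvester_mx f g *m Vandermonde _ x) i k =
    match split i with
    | inl j => x 0 k ^+ j * f.[x 0 k]
    | inr j => x 0 k ^+ j * g.[x 0 k]
    end.
Proof.
(* No coefficient of a shifted polynomial falls outside the matrix, so a row determines the full
   value at [x 0 k]. *)
have size_XnM (p : {poly R}) (m j : nat) :
    (j < m)%N -> (size ('X^j * p)%R <= m + (size p).-1)%N.
  move=> lt_jm; apply: leq_trans (size_polyMleq _ _) _.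
  rewrite size_polyXn addSn /=.
  by case: (size p) => [|n] /=; rewrite ?addnS -?addSn leq_add // ltnW.
have evalE (p : {poly R}) (j : nat) :
    (size ('X^j * p)%R <= (size g).-1 + (size f).-1)%N ->
    \sum_(c < (size g).-1 + (size f).-1)
       p`_(c - j) *+ (j <= c)%N * x 0 k ^+ c = x 0 k ^+ j * p.[x 0 k].
  move=> le_sz; rewrite -hornerXn -hornerM (horner_coef_wide _ le_sz).
  by apply: eq_bigr => c _; rewrite coefXnM ltnNge; case: leqP.
rewrite mxE.
under eq_bigr => c _ do rewrite Sylvester_mxE [Vandermonde _ _ _ _]mxE.
case: (split i) => j; rewrite evalE //; first exact: size_XnM.
by rewrite addnC; apply: size_XnM.
Qed.

Lemma ord_dvdz_sub (q : nat) (x y : 'I_q) :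
  (q%:Z %| x%:Z - y%:Z)%Z = (x == y).
Proof. by rewrite -eqz_mod_dvd !modz_nat !modn_small. Qed.

Lemma coprimez_prime (q : nat) (z : int) :
  prime q -> coprimez q%:Z z = ~~ (q%:Z %| z)%Z.
Proof. by move=> q_pr; rewrite coprimezE prime_coprime. Qed.

(** Over the field ['F_q] the reduction of [f] is nonzero, so it has fewer distinct roots than its
    size; reduction can only lower the size. *)
Lemma card_roots_mod_lt_size (q : nat) (f : {poly int}) (A : {set 'I_q}) :
    prime q -> (exists i : nat, ~~ (q%:Z %| f`_i)%Z) ->
    (forall x, x \in A -> (q%:Z %| f.[x%:Z])%Z) ->
  (#|A| < size f)%N.
Proof.
move=> q_pr [i f_i] rootA; have dvdFp := dvdz_pcharf (pchar_Fp q_pr).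
pose fq : {poly 'F_q} := map_poly intr f.
have fq_neq0 : fq != 0.
  by apply: contra f_i => /eqP fq0; rewrite dvdFp -coef_map -/fq fq0 coef0.
pose r (x : 'I_q) : 'F_q := (x%:Z)%:~R.
have r_inj : injective r.
  by move=> x y /eqP; rewrite -subr_eq0 -intrB -dvdFp ord_dvdz_sub => /eqP.
have le_size : (size fq <= size f)%N by apply: size_poly.
apply: leq_trans le_size; rewrite cardE -(size_map r).
apply: max_poly_roots => //; last by rewrite map_inj_uniq ?enum_uniq.
apply/allP=> _ /mapP[x Ax ->]; rewrite mem_enum in Ax.
by rewrite rootE horner_map -dvdFp rootA.
Qed.

Theorem theorem1 (q : nat) (f g : {poly int}) (l : nat)
    (q_prime : prime q)
    (f_neq0 : exists i : nat, ~~ (q%:Z %| f`_i)%Z)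
    (g_neq0 : exists j : nat, ~~ (q%:Z %| g`_j)%Z)
    (l_sols : #|common_roots_mod q f g| = l) :
  (resultant f g = 0 %[mod q%:Z ^+ l])%Z.
Proof.
set A := common_roots_mod q f g in l_sols.
have rootsA y : y \in A -> (q%:Z %| f.[y%:Z])%Z && (q%:Z %| g.[y%:Z])%Z.
  by rewrite inE !eqz_mod_dvd !subr0.
apply/eqP; rewrite eqz_mod_dvd subr0 -l_sols.
pose x := \row_(k < #|A|) (enum_val k : nat)%:Z.
apply: (dvdz_det_Vandermonde _ _ _ _ x) => [|i j lt_ij|i k].
(* The Vandermonde columns must fit in the [(size g).-1 + (size f).-1] rows; the second summand
   alone bounds their number. *)
- have : (#|A| < size f)%N.
    by apply: card_roots_mod_lt_size => // y /rootsA/andP[].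
  by case: (size f) => // n le_An; apply: leq_trans (leq_addl _ _).
- rewrite coprimez_prime // !mxE ord_dvdz_sub (inj_eq enum_val_inj).
  by rewrite eq_sym neq_ltn lt_ij.
- rewrite Sylvester_mx_Vandermonde mxE.
  have /andP[dvf dvg] := rootsA _ (enum_valP k).
  by case: (split i) => j; rewrite dvdz_mull.
Qed.
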